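(* Let $f:\mathbb{R}\to\mathbb{R}$ be a continuous, 1-periodic, translation-even function. Then $[\![f]\!]$ is translation-odd.
   Context: For a continuous 1-periodic function $g:\mathbb{R}\to\mathbb{R}$ (i.e. $g(y+1)=g(y)$ for all $y$) define its average over one period $\langle g\rangle:=\int_0^1 g(y)\,dy$, its fluctuating part $\{g\}(y):=g(y)-\langle g\rangle$, and, for all $y\in\mathbb{R}$, $$[\![g]\!](y):=\int_0^y\{g\}(\xi)\,d\xi-\int_0^1\int_0^\tau\{g\}(\xi)\,d\xi\,d\tau .$$ For $\sigma\in(0,1)$ let $f_\sigma(y):=f(y-\sigma)$. A 1-periodic function $f$ is called translation-even if there exists $\sigma\in(0,1)$ such that $f_\sigma(y)=f_\sigma(1-y)$ for all $y\in[0,1]$, and translation-odd if it is 1-periodic and there exists $\sigma\in(0,1)$ such that $f_\sigma(y)=-f_\sigma(1-y)$ for all $y\in[0,1]$. *)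

(* Defs.v *)
(* Stdlib real numbers, with Coquelicot's Riemann integral. *)
From Stdlib Require Import Reals.
From Coquelicot Require Import Coquelicot.
Open Scope R_scope.

Definition periodic1 (g : R -> R) : Prop := forall y : R, g (y + 1) = g y.

Definition average (g : R -> R) : R := RInt g 0 1.

Definition fluctuation (g : R -> R) (y : R) : R := g y - average g.

(* The mean-zero antiderivative of [fluctuation g], written [[g]] with double
   brackets.  [RInt] is total; every integral here exists for continuous [g],
   and [RInt _ 0 y] is the oriented integral when [y < 0]. *)
Definition dbracket (g : R -> R) (y : R) : R :=
  RInt (fluctuation g) 0 y
  - RInt (fun tau : R => RInt (fluctuation g) 0 tau) 0 1.

Definition translate (sigma : R) (f : R -> R) (y : R) : R := f (y - sigma).

Definition translation_even (f : R -> R) : Prop :=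
  periodic1 f /\
  exists sigma : R, 0 < sigma < 1 /\
    forall y : R, 0 <= y <= 1 -> translate sigma f y = translate sigma f (1 - y).

Definition translation_odd (f : R -> R) : Prop :=
  periodic1 f /\
  exists sigma : R, 0 < sigma < 1 /\
    forall y : R, 0 <= y <= 1 -> translate sigma f y = - translate sigma f (1 - y).

(* Main.v *)
(* If [G] is the double bracket of [f] and [sigma] is a centre of evenness of
   [f], then [y |-> G (y - sigma) + G (1 - y - sigma)] has derivative [0] on
   [0, 1], hence is constant there; its integral over [0, 1] is twice the mean
   of the periodic function [G], which is [0], so the constant is [0]. *)
Require Import Defs.
From Stdlib Require Import Reals Lra.
From Coquelicot Require Import Coquelicot.
Open Scope R_scope.

Lemma ex_RInt_continuous_all (g : R -> R) (a b : R) :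
  (forall x, continuous g x) -> ex_RInt g a b.
Proof. intros Hg; apply (ex_RInt_continuous (V := R_CompleteNormedModule)); intros; apply Hg. Qed.

Lemma RInt_shift (g : R -> R) (v a b : R) :
  (forall x, continuous g x) ->
  RInt (fun y => g (y + v)) a b = RInt g (a + v) (b + v).
Proof.
  intros Hg.
  assert (H := RInt_comp_lin g 1 v a b (ex_RInt_continuous_all g _ _ Hg)).
  rewrite !Rmult_1_l in H; rewrite <- H.
  apply RInt_ext; intros x _; unfold scal; simpl; unfold mult; simpl.
  now rewrite !Rmult_1_l.
Qed.

(** The substitution has slope -1; swapping the bounds of the resulting oriented integral absorbs
    the sign. *)
Lemma RInt_reflect (g : R -> R) (v a b : R) :
  (forall x, continuous g x) ->
  RInt (fun y => g (v - y)) a b = RInt g (v - b) (v - a).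
Proof.
  intros Hg.
  assert (H := RInt_comp_lin g (-1) v a b (ex_RInt_continuous_all g _ _ Hg)).
  replace (-1 * a + v) with (v - a) in H by ring.
  replace (-1 * b + v) with (v - b) in H by ring.
  rewrite <- (opp_RInt_swap g (v - a) (v - b))
    by (now apply ex_RInt_continuous_all).
  rewrite <- H, <- RInt_opp.
  - apply RInt_ext; intros x _; unfold scal, opp; simpl; unfold mult; simpl.
    replace (-1 * x + v) with (v - x) by ring; ring.
  - apply (ex_RInt_comp_lin g (-1) v), ex_RInt_continuous_all, Hg.
Qed.

(** The oriented integral from 0 to [a + 1] is split once at [a] and once at 1. By periodicity the
    piece from 1 to [a + 1] equals the piece from 0 to [a], and these cancel. *)
Lemma RInt_period (g : R -> R) (a : R) :
  (forall x, continuous g x) -> periodic1 g ->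
  RInt g a (a + 1) = RInt g 0 1.
Proof.
  intros Hg Hp.
  assert (Hex : forall u v, ex_RInt g u v)
    by (intros; now apply ex_RInt_continuous_all).
  assert (H1 := RInt_Chasles g 0 a (a + 1) (Hex _ _) (Hex _ _)).
  assert (H2 := RInt_Chasles g 0 1 (a + 1) (Hex _ _) (Hex _ _)).
  assert (H3 : RInt g 1 (a + 1) = RInt g 0 a).
  (* The lower bound 1 is written [0 + 1], so that both bounds are shifts by 1. *)
  { rewrite <- (Rplus_0_l 1) at 1; rewrite <- RInt_shift by exact Hg.
    apply RInt_ext; intros x _; apply Hp. }
  unfold plus in H1, H2; simpl in H1, H2; lra.
Qed.

Lemma fluctuation_continuous (f : R -> R) :
  (forall x, continuous f x) -> forall x, continuous (fluctuation f) x.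
Proof.
  intros hcont x.
  apply (continuous_minus f (fun _ => average f)); [apply hcont|].
  apply continuous_const.
Qed.

Lemma fluctuation_mean (f : R -> R) :
  (forall x, continuous f x) -> RInt (fluctuation f) 0 1 = 0.
Proof.
  intros hcont; unfold fluctuation.
  rewrite (RInt_minus f (fun _ => average f)).
  - rewrite RInt_const; unfold average, minus, plus, opp, scal; simpl.
    unfold mult; simpl; ring.
  - now apply ex_RInt_continuous_all.
  - apply ex_RInt_const.
Qed.

Lemma is_derive_RInt_fluctuation (f : R -> R) :
  (forall x, continuous f x) ->
  forall x, is_derive (fun y => RInt (fluctuation f) 0 y) x (fluctuation f x).
Proof.
  intros hcont x.
  apply (is_derive_RInt (fluctuation f) _ 0).
  - apply filter_forall; intros y.
    apply (@RInt_correct R_CompleteNormedModule).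
    apply ex_RInt_continuous_all, fluctuation_continuous, hcont.
  - apply fluctuation_continuous, hcont.
Qed.

Lemma is_derive_dbracket (f : R -> R) :
  (forall x, continuous f x) ->
  forall x, is_derive (dbracket f) x (fluctuation f x).
Proof.
  intros hcont x.
  rewrite <- (Rminus_0_r (fluctuation f x)).
  apply (is_derive_minus (fun y => RInt (fluctuation f) 0 y) (fun _ => _)).
  - apply is_derive_RInt_fluctuation, hcont.
  - apply (is_derive_const (V := R_NormedModule)).
Qed.

Lemma dbracket_continuous (f : R -> R) :
  (forall x, continuous f x) -> forall x, continuous (dbracket f) x.
Proof.
  intros hcont x.
  apply (ex_derive_continuous (dbracket f)).
  eexists; apply is_derive_dbracket, hcont.
Qed.

(** The constant subtracted in [dbracket] is exactly the mean over [0, 1] of the primitive it is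
    subtracted from. *)
Lemma dbracket_mean (f : R -> R) :
  (forall x, continuous f x) -> RInt (dbracket f) 0 1 = 0.
Proof.
  intros hcont; unfold dbracket at 1.
  rewrite (RInt_minus (fun y => RInt (fluctuation f) 0 y) (fun _ => _)).
  - rewrite RInt_const; unfold minus, plus, opp, scal; simpl.
    unfold mult; simpl; ring.
  - apply ex_RInt_continuous_all; intros x.
    apply (ex_derive_continuous (fun y => RInt (fluctuation f) 0 y)).
    eexists; apply is_derive_RInt_fluctuation, hcont.
  - apply ex_RInt_const.
Qed.

(** The increment over one period is the integral of [fluctuation f] over a period, which is its
    mean 0. *)
Lemma dbracket_periodic (f : R -> R) :
  (forall x, continuous f x) -> periodic1 f -> periodic1 (dbracket f).
Proof.
  intros hcont Hp y; unfold dbracket.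
  assert (Hex : forall u v, ex_RInt (fluctuation f) u v)
    by (intros; now apply ex_RInt_continuous_all, fluctuation_continuous).
  assert (H := RInt_Chasles (fluctuation f) 0 y (y + 1) (Hex _ _) (Hex _ _)).
  rewrite (RInt_period _ _ (fluctuation_continuous f hcont)) in H
    by (intros x; unfold fluctuation; now rewrite Hp).
  rewrite (fluctuation_mean f hcont) in H; unfold plus in H; simpl in H; lra.
Qed.

Theorem proposition6 (f : R -> R)
  (hcont : forall x : R, continuous f x)
  (hper : periodic1 f)
  (heven : translation_even f) :
  translation_odd (dbracket f).
Proof.
  destruct heven as [_ [s [Hs Hev]]].
  assert (HGp := dbracket_periodic f hcont hper).
  assert (HGc := dbracket_continuous f hcont).
  split; [exact HGp|].
  exists s; split; [exact Hs|].
  unfold translate in *.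
  set (G := dbracket f) in *.
  (* Oddness says that [S] vanishes on [0, 1]. The arguments are arranged to match [RInt_shift] with
     shift [- s] and [RInt_reflect] with [1 - s]. *)
  set (S := fun y => G (y + - s) + G (1 - s - y)).
  assert (HSd : forall y, 0 <= y <= 1 -> is_derive S y 0).
  { intros y Hy.
    (* Evenness of [f] passes to [fluctuation f], since both sides lose the same average. *)
    assert (E : fluctuation f (y + - s) = fluctuation f (1 - s - y)).
    { unfold fluctuation; replace (1 - s - y) with (1 - y - s) by ring.
      now rewrite <- (Hev y Hy). }
    assert (D1 := is_derive_dbracket f hcont (y + - s)).
    assert (D2 := is_derive_dbracket f hcont (1 - s - y)).
    fold G in D1, D2.
    (* The factors 1 and -1 are the slopes of the inner maps, as the chain rule produces them. *)
    replace 0 with (1 * fluctuation f (y + - s)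
                    + (-1) * fluctuation f (1 - s - y)) by (rewrite E; ring).
    apply (is_derive_plus (fun t => G (t + - s)) (fun t => G (1 - s - t))).
    - apply (is_derive_comp G (fun t => t + - s)); [exact D1|].
      auto_derive; [easy | ring].
    - apply (is_derive_comp G (fun t => 1 - s - t)); [exact D2|].
      auto_derive; [easy | ring]. }
  assert (HSc : forall y, 0 <= y <= 1 -> S y = S 0).
  (* The case [y = 0] is set apart because [eq_is_derive] needs a nondegenerate interval. *)
  { intros y Hy; destruct (Req_dec y 0) as [->|Hy0]; [easy|].
    symmetry; apply (eq_is_derive S 0 y); [|lra].
    intros t Ht; apply HSd; lra. }
  assert (Hshift : RInt (fun y => G (y + - s)) 0 1 = 0).
  { rewrite RInt_shift by exact HGc.
    (* Shift and reflection both carry [0, 1] onto the single period from [- s] to [- s + 1]. *)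
    replace (0 + - s) with (- s) by ring.
    replace (1 + - s) with (- s + 1) by ring.
    rewrite RInt_period by assumption.
    apply dbracket_mean, hcont. }
  assert (Hreflect : RInt (fun y => G (1 - s - y)) 0 1 = 0).
  { rewrite RInt_reflect by exact HGc.
    replace (1 - s - 1) with (- s) by ring.
    replace (1 - s - 0) with (- s + 1) by ring.
    rewrite RInt_period by assumption.
    apply dbracket_mean, hcont. }
  assert (HS0 : S 0 = 0).
  { transitivity (RInt S 0 1).
    - rewrite (RInt_ext S (fun _ => S 0)).
      + rewrite RInt_const; unfold scal; simpl; unfold mult; simpl; ring.
      + intros x; rewrite Rmin_left, Rmax_right by lra.
        intros Hx; apply HSc; lra.
    - unfold S; rewrite (RInt_plus (fun y => G (y + - s))
                                   (fun y => G (1 - s - y))).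
      + rewrite Hshift, Hreflect; apply Rplus_0_l.
      + apply ex_RInt_continuous_all; intros x.
        apply (continuous_comp (fun y => y + - s) G); [|apply HGc].
        apply (ex_derive_continuous (fun y => y + - s)); auto_derive; easy.
      + apply ex_RInt_continuous_all; intros x.
        apply (continuous_comp (fun y => 1 - s - y) G); [|apply HGc].
        apply (ex_derive_continuous (fun y => 1 - s - y)); auto_derive; easy. }
  intros y Hy.
  assert (H := HSc y Hy); rewrite HS0 in H; unfold S in H.
  replace (1 - y - s) with (1 - s - y) by ring.
  (* Unfolding turns [y - s] into [y + - s], so that [lra] sees the same atom [G (y + - s)] in the
     goal and in [H]. *)
  unfold Rminus at 1; lra.
Qed.
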